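(* Let $\lambda,\mu$ be partitions with $D(\mu)\subset D(\lambda)$, let $N$ be a positive integer, let $\boldsymbol s=(s_{ij})\in T^{\mathrm{diag}}(\lambda/\mu,\mathbb C)$, i.e. $s_{ij}=a_{j-i}$ for a family $(a_c)_{c\in\mathbb Z}$ of complex numbers, and let $(\theta_1,\ldots,\theta_n)$ be any outside decomposition of $\lambda/\mu$. Then \[ \zeta^{\mathrm{sp},N}_{\lambda/\mu}(\boldsymbol s)=\det\left(\zeta^{\mathrm{sp},N}_{\theta_i\#\theta_j}(\boldsymbol s_{\theta_i}\#\boldsymbol s_{\theta_j})\right)_{1\le i,j\le n}, \] where $\boldsymbol s_{\theta_i}\#\boldsymbol s_{\theta_j}$ is the filling of $\theta_i\#\theta_j$ having $a_c$ in its box of content $c$, and the $(i,j)$ entry is $1$ if $\theta_i\#\theta_j=\emptyset$ and $0$ if $\theta_i\#\theta_j$ is undefined.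
   Context: Diagrams. For a partition $\lambda=(\lambda_1,\ldots,\lambda_r)$, $D(\lambda)=\{(i,j): 1\le i\le r,\ 1\le j\le\lambda_i\}$ (row $i$ downwards, column $j$ to the right), and $D(\lambda/\mu)=D(\lambda)\setminus D(\mu)$. The content of box $(i,j)$ is $j-i$. $T^{\mathrm{diag}}(\lambda/\mu,\mathbb C)$ is the set of complex fillings of $D(\lambda/\mu)$ that are constant on diagonals of fixed content. Symplectic functions. Let $[\overline N]=\{1<\overline1<2<\overline2<\cdots<N<\overline N\}$, with $|i|=i$ and $|\overline i|=i^{-1}$. Let $E$ be a skew diagram, or a strip whose boxes carry prescribed contents. A symplectic tableau of shape $E$ is a filling of $E$ with letters of $[\overline N]$, weakly increasing along rows (left to right), strictly increasing down columns, such that each box of content $-i$ has entry $\ge i+1$ (vacuous for $-i\ge 0$). For $\boldsymbol s$ a complex filling of $E$, $\zeta_E^{\mathrm{sp},N}(\boldsymbol s)=\sum_M\prod_{\alpha\in E}|m_\alpha|^{-s_\alpha}$, summed over all symplectic tableaux $M=(m_\alpha)$ of shape $E$; $\zeta^{\mathrm{sp},N}_{\lambda/\mu}$ is the case $E=D(\lambda/\mu)$. Outside decompositions. A strip is an edgewise connected skew diagram containing no $2\times2$ block; its starting box is its bottommost-leftmost box and its ending box is its topmost-rightmost box. A box $(i,j)$ of a diagram is on its left (resp. right, top, bottom) perimeter if $(i,j-1)$ (resp. $(i,j+1)$, $(i-1,j)$, $(i+1,j)$) is not in the diagram. An outside decomposition of $\lambda/\mu$ is an ordered set $(\theta_1,\ldots,\theta_n)$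 of strips whose disjoint union is $D(\lambda/\mu)$, each having its starting box on the left or bottom perimeter of $D(\lambda/\mu)$ and its ending box on the right or top perimeter. Operation $\#$. A non-starting box of a strip is approached from the left (resp. from below) if the preceding box of the strip is immediately to its left (resp. below it). It is known that, for each content $c$, a direction $d(c)\in\{\text{left},\text{below}\}$ can be chosen so that every non-starting box of content $c$ in the strips is approached from direction $d(c)$, and every starting box of content $c$ is on the left perimeter if $d(c)=\text{left}$ and on the bottom perimeter if $d(c)=\text{below}$; if no box of $D(\lambda/\mu)$ has content $c$ then $d(c)$ is chosen arbitrarily. Fix such choices. For $p\le q$ let $R[p,q]$ be the strip with exactly one box of each content $p,p+1,\ldots,q$, where the box of content $c$ ($p<c\le q$) is immediately to the right of the box of content $c-1$ if $d(c)=\text{left}$ and immediately above it if $d(c)=\text{below}$. If $p_i$ and $q_i$ denote the contents of the starting and ending boxes of $\theta_i$ (so $\theta_i$ is a diagonal translate of $R[p_i,q_i]$), then $\theta_i\#\theta_j=R[p_j,q_i]$ if $p_j\le q_i$, $\theta_i\#\theta_j=\emptyset$ if $p_j=q_i+1$, and $\theta_i\#\theta_j$ is undefined if $p_j>q_i+1$. Boxes of $\theta_i\#\theta_j$ keep their contents $p_j,\ldots,q_i$. *)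

(* Defs.v *)
From mathcomp Require Import all_boot all_order all_algebra.
From mathcomp Require Import finmap complex.
From mathcomp Require Import reals exp trigo.

Set Implicit Arguments.
Unset Strict Implicit.
Unset Printing Implicit Defensive.

Import Order.TTheory GRing.Theory Num.Theory.
Local Open Scope fset_scope.
Local Open Scope complex_scope.
Local Open Scope ring_scope.

(* A box is a pair (row, column), rows being numbered downwards.  Coordinates
   are integers so that strips with prescribed contents can be placed at boxes
   of these very contents. *)
Definition box : Type := (int * int)%type.

Definition content (b : box) : int := b.2 - b.1.

Definition left_of (b : box) : box := (b.1, b.2 - 1).
Definition right_of (b : box) : box := (b.1, b.2 + 1).
Definition above (b : box) : box := (b.1 - 1, b.2).
Definition below (b : box) : box := (b.1 + 1, b.2).

Definition is_partition (l : seq nat) : bool := sorted geq l && (0%N \notin l).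

Definition diagram (l : seq nat) : {fset box} :=
  [fset (i%:Z, j%:Z) | i in iota 1 (size l), j in iota 1 (nth 0%N l i.-1)].

Definition skew_diagram (la mu : seq nat) : {fset box} :=
  diagram la `\` diagram mu.

Definition is_skew_diagram (E : {fset box}) : Prop :=
  exists la mu : seq nat,
    [/\ is_partition la, is_partition mu,
        diagram mu `<=` diagram la & E = skew_diagram la mu].

(* The letter i of the alphabet is (i - 1, false), and its barred version is
   (i - 1, true). *)
Definition letter (N : nat) : finType := ('I_N * bool)%type.

(* Position of a letter in 1 < 1bar < 2 < 2bar < ... , starting from 0. *)
Definition rank (N : nat) (x : letter N) : nat := (x.1.*2 + x.2)%N.

Definition letter_abs (R : realType) (N : nat) (x : letter N) : R :=
  if x.2 then (x.1.+1%:R)^-1 else x.1.+1%:R.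

(* x ^ s for real x > 0 and complex s, i.e. exp (s * ln x). *)
Definition cpow (R : realType) (x : R) (s : R[i]) : R[i] :=
  (x `^ complex.Re s)%:C *
  (cos (complex.Im s * ln x) +i* sin (complex.Im s * ln x)).

(* The letter i + 1 would have rank 2 * i; the last condition thus says that a
   box of content -i has an entry >= i + 1, including when i + 1 > N (no such
   entry exists). *)
Definition symplectic_tableau (N : nat) (E : {fset box})
    (M : {ffun E -> letter N}) : bool :=
  [&& [forall a : E, forall b : E,
         ((val a).1 == (val b).1) && ((val a).2 < (val b).2) ==>
         (rank (M a) <= rank (M b))%N],
      [forall a : E, forall b : E,
         ((val a).2 == (val b).2) && ((val a).1 < (val b).1) ==>
         (rank (M a) < rank (M b))%N]
    & [forall a : E, 2 * - content (val a) <= (rank (M a))%:Z]].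

Definition zeta_sp (R : realType) (N : nat) (E : {fset box}) (s : E -> R[i]) :
    R[i] :=
  \sum_(M : {ffun E -> letter N} | symplectic_tableau M)
    \prod_(a : E) cpow (letter_abs R (M a)) (- s a).

Definition edge_adjacent (a b : box) : bool :=
  b \in [:: left_of a; right_of a; above a; below a].

Definition edgewise_connected (E : {fset box}) : Prop :=
  forall a b : E, connect (fun x y : E => edge_adjacent (val x) (val y)) a b.

Definition has_2x2_block (E : {fset box}) : Prop :=
  exists b : box,
    [/\ b \in E, right_of b \in E, below b \in E & right_of (below b) \in E].

Definition is_strip (E : {fset box}) : Prop :=
  [/\ E != fset0, is_skew_diagram E, edgewise_connected E & ~ has_2x2_block E].

(* The bottommost-leftmost and topmost-rightmost boxes; the default value (0, 0)
   is not used when E is a strip. *)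
Definition start_box (E : {fset box}) : box :=
  odflt (0, 0) (omap val [pick a : E | [forall b : E,
    ((val b).1 <= (val a).1) && ((val a).2 <= (val b).2)]]).

Definition end_box (E : {fset box}) : box :=
  odflt (0, 0) (omap val [pick a : E | [forall b : E,
    ((val a).1 <= (val b).1) && ((val b).2 <= (val a).2)]]).

Definition left_perimeter (D : {fset box}) (b : box) : bool :=
  (b \in D) && (left_of b \notin D).
Definition right_perimeter (D : {fset box}) (b : box) : bool :=
  (b \in D) && (right_of b \notin D).
Definition top_perimeter (D : {fset box}) (b : box) : bool :=
  (b \in D) && (above b \notin D).
Definition bottom_perimeter (D : {fset box}) (b : box) : bool :=
  (b \in D) && (below b \notin D).

Definition outside_decomposition (D : {fset box}) (n : nat)
    (theta : 'I_n -> {fset box}) : Prop :=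
  [/\ forall i, is_strip (theta i),
      forall i j, i != j -> [disjoint theta i & theta j],
      forall b, b \in D <-> exists i, b \in theta i
    & forall i,
        (left_perimeter D (start_box (theta i)) \/
         bottom_perimeter D (start_box (theta i))) /\
        (right_perimeter D (end_box (theta i)) \/
         top_perimeter D (end_box (theta i)))].

Inductive direction : Type := FromLeft | FromBelow.

(* A strip contains at most one of left_of b and below b for each of its boxes
   b, and that box is the one preceding b in the strip. *)
Definition approached_from (E : {fset box}) (b : box) (d : direction) : Prop :=
  match d with
  | FromLeft => left_of b \in E
  | FromBelow => below b \in E
  end.

Definition on_perimeter_of (D : {fset box}) (b : box) (d : direction) : Prop :=
  match d with
  | FromLeft => left_perimeter D b
  | FromBelow => bottom_perimeter D b
  end.

Definition compatible_directions (D : {fset box}) (n : nat)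
    (theta : 'I_n -> {fset box}) (d : int -> direction) : Prop :=
  (forall i b, b \in theta i -> b != start_box (theta i) ->
     approached_from (theta i) b (d (content b))) /\
  (forall i, on_perimeter_of D (start_box (theta i))
     (d (content (start_box (theta i))))).

(* The box of content p + k of the strip which starts at the box (0, p). *)
Fixpoint strip_box (d : int -> direction) (p : int) (k : nat) : box :=
  match k with
  | 0%N => (0, p)
  | k'.+1 =>
      match d (p + k%:Z) with
      | FromLeft => right_of (strip_box d p k')
      | FromBelow => above (strip_box d p k')
      end
  end.

(* R[p, q], for p <= q. *)
Definition strip_between (d : int -> direction) (p q : int) : {fset box} :=
  [fset strip_box d p k | k in iota 0 `|q - p|%N.+1].

(* The strip theta # theta', or None when it is undefined. *)
Definition hash (d : int -> direction) (theta theta' : {fset box}) :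
    option {fset box} :=
  let p := content (start_box theta') in
  let q := content (end_box theta) in
  if p <= q then Some (strip_between d p q)
  else if p == q + 1 then Some fset0
  else None.

Definition hash_entry (R : realType) (N : nat) (a : int -> R[i])
    (d : int -> direction) (theta theta' : {fset box}) : R[i] :=
  match hash d theta theta' with
  | Some E => if E == fset0 then 1
              else zeta_sp N (fun b : E => a (content (val b)))
  | None => 0
  end.

(* Main.v *)
Require Import Defs.
From mathcomp Require Import all_boot all_order all_fingroup all_algebra.
From mathcomp Require Import finmap complex zify.
From mathcomp Require Import reals exp trigo.

Set Implicit Arguments.
Unset Strict Implicit.
Unset Printing Implicit Defensive.

Import Order.TTheory GRing.Theory Num.Theory.
Local Open Scope fset_scope.
Local Open Scope ring_scope.

(** This is the Hamel-Goulden determinant with weights that depend on the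
    content of a box as well as on its letter.  The symplectic condition bounds
    the entry of a box in terms of its content only, so it is absorbed by giving
    weight 0 to the letters that are too small ([letter_weight]).  What remains
    is a sum over ordinary semistandard fillings of a skew diagram, weighted by
    [w c v] for a letter [v] in a box of content [c].

    The proof sweeps the diagram one diagonal (one content) at a time.  Fix the
    letters [x] of the diagonal of content [c].  Attach to them the n x n matrix
    whose row [i] tells what strip [i] still has to do: if the strip is
    already finished, the [i]-th unit row; if it has a box of content [c], the
    generating functions [tail_sum] of all ways to continue it from its letter to
    each of the end contents [q j]; if it has not started yet, the generating
    functions [strip_sum] of all complete strips from [p i] to [q j].  To the left
    of the diagram this matrix is the transpose of the matrix of the theorem, to the
    right of it it is the identity.

    The core is the identity [diagonal_det_step]: the determinant attached to
    diagonal [c] is the sum, over all letters [y] of diagonal [c + 1] that are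
    compatible with [x], of their weights times the determinant attached to [y].
    Along the cutting direction [d (c + 1)] the letters allowed after [x_1], [x_2],
    ... on the diagonal form a chain of nested sets.  Subtracting from the row of
    each strip the row of the next strip of the chain therefore replaces each set
    by a difference of consecutive ones, which is the other half of
    the semistandard conditions; then the determinant is expanded
    multilinearly in its rows.  At most one strip ends on diagonal [c]; it comes
    last in the chain and, after the subtraction, its column is a unit column, so
    that the rest of its row is irrelevant ([det_unit_col]).  Indexing rows by
    strips rather than by positions along the diagonal is what avoids any sign.

    Iterating this identity ([path_sum]) yields [tableau_sum_det].  Applied to a
    decomposition with a single strip, the same result identifies [strip_sum p q]
    with the zeta function of the strip R[p,q], that is, with the matrix entries
    of the theorem ([hash_entry_strip_sum]). *)

(** * Determinants and sums over paths *)

(** The matrix of the row operation is unipotent: in the Leibniz expansion of its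
    determinant, a permutation that contributes moves each [i] to [i] or to
    [sigma i], hence never raises [rho], and preserves the sum of [rho]. *)
Lemma det_sub_rows (R : comNzRingType) n (A : 'M[R]_n)
    (sigma : 'I_n -> option 'I_n) (rho : 'I_n -> int) :
  (forall i k, sigma i = Some k -> rho k < rho i) ->
  \det (\matrix_(i, j) (A i j - oapp (A^~ j) 0 (sigma i))) = \det A.
Proof.
move=> rhoP.
pose U : 'M[R]_n := \matrix_(i, k) ((i == k)%:R - (sigma i == Some k)%:R).
have -> : (\matrix_(i, j) (A i j - oapp (A^~ j) 0 (sigma i))) = U *m A.
  apply/matrixP => i j; rewrite !mxE.
  under eq_bigr => k _ do rewrite mxE mulrBl.
  rewrite sumrB (bigD1 i) //= eqxx mul1r big1 ?addr0 => [|k ki]; last first.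
    by rewrite eq_sym (negPf ki) mul0r.
  congr (_ - _); case E: (sigma i) => [k|] /=.
    rewrite (bigD1 k) //= eqxx mul1r big1 ?addr0 // => l lk.
    by rewrite (inj_eq Some_inj) eq_sym (negPf lk) mul0r.
  by rewrite big1 // => k _; rewrite mul0r.
rewrite det_mulmx; suff -> : \det U = 1 by rewrite mul1r.
rewrite /determinant (bigD1 (1%g : {perm 'I_n})) //= odd_perm1 expr0 mul1r.
rewrite [X in X + _]big1 => [|i _]; last first.
  rewrite mxE perm1 eqxx; case E: (sigma i == _); last by rewrite subr0.
  by move/eqP: E => /rhoP; rewrite ltxx.
rewrite big1 ?addr0 // => s s1.
have [i0 Hi0] : exists i, s i != i.
  apply/existsP; apply: contraNT s1; rewrite negb_exists => /forallP H.
  by apply/eqP/permP => i; rewrite perm1; apply/eqP; move: (H i); rewrite negbK.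
case: (boolP [forall i, (s i == i) || (sigma i == Some (s i))]) => [/forallP H|].
  have le i : rho (s i) <= rho i.
    by case/orP: (H i) => [/eqP ->//|/eqP /rhoP /ltW].
  have lt0 : rho (s i0) < rho i0.
    by case/orP: (H i0) => [/eqP E|/eqP /rhoP //]; rewrite E eqxx in Hi0.
  have : \sum_i rho (s i) < \sum_i rho i.
    rewrite (bigD1 i0) //= [X in _ < X](bigD1 i0) //=.
    by rewrite ltr_leD //; apply: ler_sum.
  by rewrite [X in _ < X](reindex_inj (@perm_inj _ s)) ltxx.
move=> H; case: (elimT forallPn H) => i; rewrite negb_or => /andP[/negPf a /negPf b].
by rewrite (bigD1 i) //= mxE eq_sym a b subr0 mul0r mulr0.
Qed.

Lemma det_sum_rows (R : comNzRingType) n (L : finType) (k : 'I_n -> L -> R)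
    (V : 'I_n -> L -> 'I_n -> R) :
  \det (\matrix_(i, j) \sum_v k i v * V i v j) =
  \sum_(y : {ffun 'I_n -> L})
     (\prod_i k i (y i)) * \det (\matrix_(i, j) V i (y i) j).
Proof.
rewrite /determinant.
under [RHS]eq_bigr => y _ do rewrite mulr_sumr.
rewrite exchange_big /=; apply: eq_bigr => s _.
under eq_bigr => i _ do rewrite mxE.
rewrite bigA_distr_bigA /= mulr_sumr; apply: eq_bigr => y _.
rewrite mulrCA; congr (_ * _); rewrite -big_split /=.
by apply: eq_bigr => i _; rewrite mxE.
Qed.

(** Expanding along column [f] shows that the other entries of row [f] do not
    contribute. *)
Lemma det_unit_col (R : comNzRingType) n (A B : 'M[R]_n) (f : 'I_n) :
  (forall i, A i f = (i == f)%:R) -> (forall i, B i f = (i == f)%:R) ->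
  (forall i j, i != f -> A i j = B i j) -> \det A = \det B.
Proof.
move=> Af Bf AB; rewrite (expand_det_col A f) (expand_det_col B f).
apply: eq_bigr => i _; rewrite Af Bf.
have [->|] := eqVneq i f; last by rewrite !mul0r.
rewrite !mul1r /cofactor; congr (_ * \det _); apply/matrixP => k l.
by rewrite !mxE AB // eq_sym neq_lift.
Qed.

(** A one-step recursion for [F] unfolds to a sum over paths.  The recursion is
    only required at states satisfying an invariant [P], which every step of
    nonzero weight establishes for the next state. *)
Lemma path_sum (R : comNzRingType) (X : finType) (F : nat -> X -> R)
    (K : nat -> X -> X -> R) (P : nat -> X -> Prop) :
  (forall t x, P t x -> F t x = \sum_y K t x y * F t.+1 y) ->
  (forall t x y, K t x y != 0 -> P t.+1 y) ->
  forall T t x, P t x ->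
  F t x = \sum_(Y : T.-tuple X)
    (\prod_(u < T) K (t + u)%N (nth x (x :: Y) u) (nth x Y u)) *
    F (t + T)%N (last x Y).
Proof.
move=> FP KP; elim=> [|T IH] t x Px.
  rewrite (big_pred1 [tuple]) => [|Y]; last by apply/esym/eqP/tuple0.
  by rewrite big_ord0 mul1r addn0.
rewrite (reindex (fun z : X * T.-tuple X => [tuple of z.1 :: z.2])) /=; last first.
  exists (fun Y => (thead Y, [tuple of behead Y])) => [[y Y]|Y] _ /=.
    by congr pair; apply/val_inj.
  by rewrite -tuple_eta.
rewrite -(pair_bigA _ (fun y (Y : T.-tuple X) =>
  (\prod_(u < T.+1) K (t + u)%N (nth x (x :: y :: Y) u) (nth x (y :: Y) u)) *
  F (t + T.+1)%N (last y Y))) /= (FP _ _ Px); apply: eq_bigr => y _.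
under eq_bigr => Y _ do rewrite big_ord_recl /= addn0 -mulrA.
rewrite -mulr_sumr; have [->|/KP Py] := eqVneq (K t x y) 0; first by rewrite !mul0r.
rewrite (IH _ _ Py); congr (_ * _); apply: eq_bigr => Y _.
rewrite addSnnS; congr (_ * _); apply: eq_bigr => u _.
rewrite /= /bump /= add1n addSnnS; congr K; apply: set_nth_default.
  by rewrite /= size_tuple ltnS ltnW.
by rewrite size_tuple.
Qed.

(** * Diagrams cut into directed strips *)

Definition box_convex (D : {fset box}) : Prop :=
  forall a b z : box, a \in D -> b \in D ->
    a.1 <= z.1 <= b.1 -> a.2 <= z.2 <= b.2 -> z \in D.

Definition predecessor (e : direction) : box -> box :=
  match e with FromLeft => left_of | FromBelow => below end.

Definition other_neighbour (e : direction) : box -> box :=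
  match e with FromLeft => below | FromBelow => left_of end.

(** A coordinate shared by a box and its predecessor, which decreases by one
    when passing to the other neighbour; it orders the strips that cross a given
    pair of consecutive diagonals. *)
Definition level (e : direction) (b : box) : int :=
  match e with FromLeft => - b.1 | FromBelow => b.2 end.

Definition diag_next (b : box) : box := (b.1 + 1, b.2 + 1).

Definition in_span n (p q : 'I_n -> int) (i : 'I_n) (c : int) : bool :=
  (p i <= c) && (c <= q i).

Lemma content_left b : content (left_of b) = content b - 1.
Proof. by rewrite /content /=; lia. Qed.

Lemma content_below b : content (below b) = content b - 1.
Proof. by rewrite /content /=; lia. Qed.

Lemma content_predecessor e b : content (predecessor e b) = content b - 1.
Proof. by case: e; [apply: content_left | apply: content_below]. Qed.

Lemma content_other e b : content (other_neighbour e b) = content b - 1.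
Proof. by case: e; [apply: content_below | apply: content_left]. Qed.

Lemma level_predecessor e b : level e (predecessor e b) = level e b.
Proof. by case: e. Qed.

Lemma level_other e b : level e (other_neighbour e b) = level e b - 1.
Proof. by case: e => //=; lia. Qed.

(** What the sweep uses of an outside decomposition: strip [i] meets exactly the
    diagonals of content [p i] to [q i], once each, it proceeds in direction [d],
    and it cannot be prolonged backwards inside [D].  That it cannot be
    prolonged forwards either is a consequence ([span_end_successor]). *)
Record strip_system (D : {fset box}) (d : int -> direction) (n : nat)
    (p q : 'I_n -> int) (strip_of : box -> 'I_n) (box_at : 'I_n -> int -> box) :
  Prop := StripSystem {
  span_nonempty : forall i, p i <= q i;
  strip_of_span : forall b, b \in D -> in_span p q (strip_of b) (content b);
  strip_ofK : forall b, b \in D -> box_at (strip_of b) (content b) = b;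
  box_at_in : forall i c, in_span p q i c -> box_at i c \in D;
  box_at_content : forall i c, in_span p q i c -> content (box_at i c) = c;
  box_atK : forall i c, in_span p q i c -> strip_of (box_at i c) = i;
  box_at_step : forall i c, in_span p q i (c - 1) -> in_span p q i c ->
    predecessor (d c) (box_at i c) = box_at i (c - 1);
  box_at_start : forall i, predecessor (d (p i)) (box_at i (p i)) \notin D
}.

(** * Generating functions of strips *)

Section Transfer.

Variables (R : comNzRingType) (L : finType) (rank : L -> nat).
Variables (w : int -> L -> R) (d : int -> direction) (x0 : L).

Definition step (c : int) (x y : L) : bool :=
  match d c with
  | FromLeft => (rank x <= rank y)%N
  | FromBelow => (rank y < rank x)%N
  end.

Fixpoint walk_sum (k : nat) (c : int) (x : L) : R :=
  if k is k'.+1 then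
    \sum_(y | step (c + 1) x y) w (c + 1) y * walk_sum k' (c + 1) y
  else 1.

(** The letter [x] sits in a box of content [c], whose own weight is not
    counted; the walk ends at content [q]. *)
Definition tail_sum (c : int) (x : L) (q : int) : R :=
  if c <= q then walk_sum (absz (q - c)%R) c x else 0.

(** The second summand vanishes when [q < p]; the first one is the convention
    that the empty strip, with [p = q + 1], counts for 1. *)
Definition strip_sum (p q : int) : R :=
  (q + 1 == p)%:R + \sum_y w p y * tail_sum p y q.

(** Stopping at [c] or making one more step; the form is uniform in [q], so that
    it can be used in a whole row of the matrix. *)
Lemma tail_sumE c x q :
  tail_sum c x q =
  (q == c)%:R + \sum_(y | step (c + 1) x y) w (c + 1) y * tail_sum (c + 1) y q.
Proof.
rewrite /tail_sum; have [cq|cq|->] := ltgtP c q.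
- have -> : (c + 1 <= q) by lia.
  have -> : absz (q - c)%R = (absz (q - (c + 1))%R).+1 by lia.
  by rewrite add0r.
- have -> : (c + 1 <= q) = false by lia.
  by rewrite add0r big1 // => y _; rewrite mulr0.
- have -> : (q + 1 <= q) = false by lia.
  by rewrite subrr big1 ?addr0 // => y _; rewrite mulr0.
Qed.

Lemma tail_sum_past c x q : q < c -> tail_sum c x q = 0.
Proof. by rewrite /tail_sum ltNge; case: (c <= q). Qed.

Lemma strip_sum_past p q : q + 1 < p -> strip_sum p q = 0.
Proof.
move=> qp; rewrite /strip_sum lt_eqF // add0r big1 // => y _.
by rewrite tail_sum_past ?mulr0 //; lia.
Qed.

(** * The determinant attached to a diagonal *)

Section Diagram.

Variables (D : {fset box}) (n : nat) (p q : 'I_n -> int).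
Variables (strip_of : box -> 'I_n) (box_at : 'I_n -> int -> box).
Hypotheses (convD : box_convex D) (sysD : strip_system D d p q strip_of box_at).

(** A diagonal is recorded strip by strip; strips that do not meet it carry the
    default letter [x0]. *)
Let X : finType := {ffun 'I_n -> L}.

Definition strip_row (c : int) (i : 'I_n) (v : L) (j : 'I_n) : R :=
  if q i < c then (i == j)%:R
  else if p i <= c then tail_sum c v (q j) else strip_sum (p i) (q j).

Definition diagonal_det (c : int) (x : X) : R :=
  \det (\matrix_(i, j) strip_row c i (x i) j).

(** Both neighbours of [b] have content one less, so their letters are those of
    the state [x] of the preceding diagonal; in this form the condition does not
    involve the direction of the strips. *)
Definition fits (x : X) (b : box) (v : L) : bool :=
  ((left_of b \in D) ==> (rank (x (strip_of (left_of b))) <= rank v)%N) &&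
  ((below b \in D) ==> (rank v < rank (x (strip_of (below b))))%N).

Definition transfer (c : int) (x : X) (i : 'I_n) (v : L) : R :=
  if in_span p q i c then (fits x (box_at i c) v)%:R * w c v else (v == x0)%:R.

Definition diagonal_increasing (c : int) (x : X) : Prop :=
  forall b, b \in D -> content b = c -> diag_next b \in D ->
    (rank (x (strip_of b)) <= rank (x (strip_of (diag_next b))))%N.

(** Strips are maximal backwards: a predecessor inside [D] never belongs to
    another strip. *)
Lemma predecessor_strip b : b \in D -> predecessor (d (content b)) b \in D ->
  strip_of (predecessor (d (content b)) b) = strip_of b /\
  in_span p q (strip_of b) (content b - 1).
Proof.
move=> bD preD; have sb := strip_of_span sysD bD.
have eb := strip_ofK sysD bD.
have sb1 : in_span p q (strip_of b) (content b - 1).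
  have : content b != p (strip_of b).
    apply: contraL preD => /eqP ep; rewrite ep.
    by rewrite -{2}eb ep; apply: (box_at_start sysD).
  by move: sb; rewrite /in_span; lia.
by split=> //; rewrite -{2}eb (box_at_step sysD) // (box_atK sysD).
Qed.

Lemma box_predecessor i c : in_span p q i c ->
  (predecessor (d c) (box_at i c) \in D) = in_span p q i (c - 1).
Proof.
move=> ic; have bD := box_at_in sysD ic; have cb := box_at_content sysD ic.
have si := box_atK sysD ic.
apply/idP/idP => [preD|ic1]; last by rewrite (box_at_step sysD) // (box_at_in sysD).
by have := @predecessor_strip _ bD; rewrite cb si => /(_ preD) [].
Qed.

(** Between two consecutive boxes of a diagonal lies, by convexity, a box of the
    preceding diagonal that separates their letters. *)
Lemma transfer_increasing c (x y : X) :
  \prod_i transfer (c + 1) x i (y i) != 0 -> diagonal_increasing (c + 1) y.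
Proof.
move=> nz; have fitsP b : b \in D -> content b = c + 1 ->
    fits x b (y (strip_of b)).
  move=> bD cb; apply: contraNT nz => nf; apply/eqP.
  rewrite (bigD1 (strip_of b)) //= /transfer -cb (strip_of_span sysD) //.
  by rewrite (strip_ofK sysD) // (negPf nf) !mul0r.
move=> b bD cb nD.
have zD : below b \in D by apply: (convD bD nD) => /=; lia.
have zE : left_of (diag_next b) = below b by rewrite /left_of /= addrK.
have /andP[_] := fitsP _ bD cb; rewrite zD /= => lt1.
have /andP[+ _] : fits x (diag_next b) (y (strip_of (diag_next b))).
  by apply: fitsP => //; rewrite -cb /content /=; lia.
by rewrite zE zD /= => le2; apply/ltnW/(leq_trans lt1).
Qed.

Definition successor (e : direction) : box -> box :=
  match e with FromLeft => right_of | FromBelow => above end.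

Lemma span_end_successor i c : in_span p q i c -> q i = c ->
  successor (d (c + 1)) (box_at i c) \notin D.
Proof.
move=> ic qi; set e := d _; set a := box_at i c.
have aD : a \in D := box_at_in sysD ic.
have ac : content a = c := box_at_content sysD ic.
apply/negP => zD; set z := successor e a in zD.
have preE : predecessor e z = a.
  by rewrite /z; case: (e) => /=; rewrite /left_of /below /= ?addrK ?subrK; case: (a).
have zc : content z = c + 1.
  by have := content_predecessor e z; rewrite preE ac; lia.
have := strip_of_span sysD zD; have := predecessor_strip zD.
rewrite zc -/e preE aD (box_atK sysD ic) => /(_ isT)[<- _].
by rewrite /in_span qi; lia.
Qed.

(** When a strip ends at [a], the box after [a] is missing, so by convexity the
    next diagonal lies on one side of [a]: each of its boxes keeps its other
    neighbour, that is, every strip of that diagonal has a successor in the chain. *)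
Lemma span_end_other e a z : a \in D -> successor e a \notin D ->
  z \in D -> content z = content a + 1 -> other_neighbour e z \in D.
Proof.
case: a z => [i j] [r s] aD; rewrite /content /= => sD zD cE.
case: e sD => /= sD; have [lt|ge] := ltP r i.
- by apply: (convD zD aD) => /=; lia.
- by case/negP: sD; apply: (convD aD zD) => /=; lia.
- by case/negP: sD; apply: (convD zD aD) => /=; lia.
- by apply: (convD aD zD) => /=; lia.
Qed.

(** At most one strip ends on each diagonal: the box after the earlier of two
    ends, or after the later one, would lie between them. *)
Lemma span_end_uniq e a b : a \in D -> b \in D -> content a = content b ->
  successor e a \notin D -> successor e b \notin D -> a = b.
Proof.
case: a b => [i j] [r s] aD bD; rewrite /content /= => cE sa sb.
have [lt|gt|E] := ltgtP i r; last by congr pair; lia.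
- case: e sa sb => /= sa sb.
    by case/negP: sa; apply: (convD aD bD) => /=; lia.
  by case/negP: sb; apply: (convD aD bD) => /=; lia.
- case: e sa sb => /= sa sb.
    by case/negP: sb; apply: (convD bD aD) => /=; lia.
  by case/negP: sa; apply: (convD bD aD) => /=; lia.
Qed.

(** A strip continuing to diagonal [c + 1] and a strip starting there have rows of
    the same shape; for the latter every letter is allowed. *)
Lemma strip_row_active c (x : X) i j : in_span p q i (c + 1) ->
  strip_row c i (x i) j = (q j == c)%:R +
    \sum_(y | (predecessor (d (c + 1)) (box_at i (c + 1)) \in D) ==>
       step (c + 1) (x (strip_of (predecessor (d (c + 1)) (box_at i (c + 1))))) y)
       w (c + 1) y * tail_sum (c + 1) y (q j).
Proof.
move=> ic; rewrite box_predecessor // addrK /strip_row.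
have -> : (q i < c) = false by move: ic; rewrite /in_span; lia.
case: ifP => pi; last first.
  have -> : p i = c + 1 by move: ic; rewrite /in_span; lia.
  rewrite /strip_sum (inj_eq (addIr 1)); congr (_ + _); apply: eq_bigl => y.
  by rewrite /in_span pi.
have ic0 : in_span p q i c by move: ic; rewrite /in_span; lia.
rewrite ic0 tail_sumE; congr (_ + _); apply: eq_bigl => y /=.
have bD := box_at_in sysD ic; have := predecessor_strip bD.
by rewrite (box_at_content sysD ic) box_predecessor // addrK ic0 (box_atK sysD ic)
  => /(_ isT)[->].
Qed.

(** The semistandard conditions say that [v] is in the set of letters allowed
    after the predecessor and outside the set allowed after the other
    neighbour. *)
Lemma fitsE c (x : X) b v :
  fits x b v =
  ((predecessor (d c) b \in D) ==> step c (x (strip_of (predecessor (d c) b))) v)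
  && ((other_neighbour (d c) b \in D) ==>
       ~~ step c (x (strip_of (other_neighbour (d c) b))) v).
Proof.
rewrite /fits /step; case: (d c) => /=; first by rewrite -ltnNge.
by rewrite andbC -leqNgt.
Qed.

(** The sets of allowed letters are nested along the diagonal; this is where the
    letters of the diagonal need to be increasing. *)
Lemma step_other_predecessor c (x : X) b v : diagonal_increasing (c - 1) x ->
  content b = c -> predecessor (d c) b \in D -> other_neighbour (d c) b \in D ->
  step c (x (strip_of (other_neighbour (d c) b))) v ->
  step c (x (strip_of (predecessor (d c) b))) v.
Proof.
move=> inc cb; rewrite /step; have := inc (left_of b).
have -> : diag_next (left_of b) = below b by rewrite /diag_next /= subrK.
rewrite content_left cb; case: (d c) => /= le pD oD H.
  by apply: leq_trans H; apply: le.
by apply: leq_trans H _; apply: le.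
Qed.

(** Subtracting from each row the row of the next strip of the chain turns the
    nested sets of allowed letters into their differences. *)
Lemma diagonal_det_step c (x : X) : diagonal_increasing c x ->
  diagonal_det c x =
  \sum_(y : X) (\prod_i transfer (c + 1) x i (y i)) * diagonal_det (c + 1) y.
Proof.
move=> inc; rewrite /diagonal_det -det_sum_rows.
set e := d (c + 1).
pose oth i := other_neighbour e (box_at i (c + 1)).
pose sigma i := if in_span p q i (c + 1) && (oth i \in D)
                then Some (strip_of (oth i)) else None.
pose rho i := if in_span p q i (c + 1) then level e (box_at i (c + 1))
              else level e (box_at i c).
have sigmaP i k : sigma i = Some k ->
    [/\ in_span p q i (c + 1), oth i \in D, k = strip_of (oth i),
        in_span p q k c & box_at k c = oth i].
  rewrite /sigma; case: ifP => // /andP[ic oD] [<-].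
  have oc : content (oth i) = c.
    by rewrite content_other (box_at_content sysD ic) addrK.
  by split=> //; [rewrite -oc (strip_of_span sysD) | rewrite -oc (strip_ofK sysD)].
have rhoP i k : sigma i = Some k -> rho k < rho i.
  case/sigmaP => ic oD _ kc kE; rewrite {2}/rho ic.
  suff -> : rho k = level e (box_at k c) by rewrite kE level_other; lia.
  rewrite /rho; case: ifP => // kc1.
  by rewrite -level_predecessor (box_at_step sysD) ?addrK.
(* [A] is the matrix after the row operations and [B] the one to be expanded; they
   can only differ in the row of the strip that ends at content [c]. *)
rewrite -(det_sub_rows _ rhoP); set A := (X in \det X); set B := (X in _ = \det X).
have Bin i j : ~~ in_span p q i (c + 1) -> B i j = strip_row (c + 1) i x0 j.
  move=> /negPf ic; rewrite mxE (bigD1 x0) //= /transfer ic eqxx mul1r.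
  by rewrite big1 ?addr0 // => v /negPf ->; rewrite mul0r.
have AE i j : in_span p q i (c + 1) ->
    A i j = (if sigma i is Some _ then 0 else (q j == c)%:R) + B i j.
  move=> ic; rewrite !mxE strip_row_active //.
  have BE : \sum_v transfer (c + 1) x i v * strip_row (c + 1) i v j =
      \sum_(v | fits x (box_at i (c + 1)) v) w (c + 1) v * tail_sum (c + 1) v (q j).
    rewrite [RHS]big_mkcond /=; apply: eq_bigr => v _.
    rewrite /transfer /strip_row ic.
    have /andP[-> qi] := ic; rewrite ltNge qi /=.
    by case: ifP; rewrite ?mul1r ?mul0r.
  rewrite BE; case E: (sigma i) => [k|] /=; last first.
    rewrite subr0; congr (_ + _); apply: eq_bigl => v; rewrite (fitsE (c + 1)).
    have oF : (other_neighbour (d (c + 1)) (box_at i (c + 1)) \in D) = false.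
      by move: E; rewrite /sigma ic /oth /=; case: ifP.
    by rewrite oF andbT.
  have [_ oD kE kc _] := sigmaP _ _ E.
  rewrite mxE /strip_row; have /andP[-> qk] := kc; rewrite ltNge qk /= tail_sumE.
  rewrite opprD addrACA subrr; congr (_ + _).
  rewrite [X in X - _]big_mkcond [X in _ - X]big_mkcond [RHS]big_mkcond /=.
  rewrite -sumrB; apply: eq_bigr => v _; rewrite (fitsE (c + 1)) -/e.
  rewrite -/(oth i) oD -kE /=.
  have imp : step (c + 1) (x k) v -> (predecessor e (box_at i (c + 1)) \in D) ==>
      step (c + 1) (x (strip_of (predecessor e (box_at i (c + 1))))) v.
    move=> st; apply/implyP => pD; apply: step_other_predecessor => //.
    - by rewrite addrK.
    - exact: (box_at_content sysD).
    - by rewrite -/e -/(oth i) -kE.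
  case: (step _ (x k) v) imp => [->//|_]; first by rewrite subrr.
  by rewrite andbT subr0.
have Aold i j : ~~ in_span p q i (c + 1) -> q i != c -> A i j = B i j.
  move=> ic qi; rewrite Bin // !mxE /sigma (negPf ic) /= subr0 /strip_row.
  have := span_nonempty sysD i.
  move: ic; rewrite /in_span => ic pq.
  have -> : (q i < c + 1) = (q i < c) by lia.
  case: ifP => // qc.
  by have [-> ->] : (p i <= c) = false /\ (p i <= c + 1) = false by lia.
have [f /eqP qf|noend] := pickP [pred f | q f == c]; last first.
  have nq i : (q i == c) = false by exact: noend.
  congr (\det _); apply/matrixP => i j.
  have [ic|ic] := boolP (in_span p q i (c + 1)); last by rewrite Aold // nq.
  by rewrite AE // nq; case: (sigma i) => [k|]; rewrite add0r.
have fc : in_span p q f c by rewrite /in_span qf lexx andbT -qf (span_nonempty sysD).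
have fc1 : ~~ in_span p q f (c + 1) by rewrite /in_span qf; lia.
have aD := box_at_in sysD fc; have ac := box_at_content sysD fc.
have send := span_end_successor fc qf.
have quniq i : q i = c -> i = f.
  move=> qi; have ic : in_span p q i c.
    by rewrite /in_span qi lexx andbT -qi (span_nonempty sysD).
  rewrite -(box_atK sysD ic) -(box_atK sysD fc); congr strip_of.
  apply: span_end_uniq send => //; first exact: (box_at_in sysD).
    by rewrite ac (box_at_content sysD).
  exact: span_end_successor.
have sigmaN i : in_span p q i (c + 1) -> sigma i <> None.
  move=> ic; rewrite /sigma ic /= /oth; case: ifP => // /negP[].
  apply: span_end_other aD send _ _; first exact: (box_at_in sysD).
  by rewrite ac (box_at_content sysD).
have AB i j : i != f -> A i j = B i j.
  move=> fi; have [ic|ic] := boolP (in_span p q i (c + 1)).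
    by rewrite AE //; case: (sigma i) (sigmaN _ ic) => // k _; rewrite add0r.
  by apply: Aold => //; apply: contra fi => /eqP /quniq ->.
have Bf i : B i f = (i == f)%:R.
  have [ic|ic] := boolP (in_span p q i (c + 1)).
    rewrite mxE big1 => [|v _].
      by case: eqP => // fi; move: fc1; rewrite -fi ic.
    rewrite /strip_row; move: ic => /andP[-> qi]; rewrite ltNge qi /=.
    by rewrite tail_sum_past ?mulr0 // qf; lia.
  rewrite Bin // /strip_row; case: ifP => // qi.
  have pi : c + 1 < p i.
    by move: ic; rewrite /in_span; have := span_nonempty sysD i; lia.
  rewrite leNgt pi /= strip_sum_past ?qf //.
  by case: eqP => // fi; move: qi; rewrite fi qf; lia.
apply: (@det_unit_col _ _ _ _ f) => // i.
have [->|fi] := eqVneq i f; last by rewrite AB // Bf (negPf fi).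
rewrite !mxE /sigma (negPf fc1) /= subr0 /strip_row qf ltxx.
have /andP[-> _] := fc.
by rewrite /tail_sum lexx subrr.
Qed.

(** * The sum over all fillings *)

Definition entry (M : {ffun D -> L}) (b : box) : L := oapp M x0 (insub b).

Lemma entry_val (M : {ffun D -> L}) (b : D) : entry M (val b) = M b.
Proof. by rewrite /entry valK. Qed.

Definition locally_ordered (M : {ffun D -> L}) (b : box) : bool :=
  ((left_of b \in D) ==> (rank (entry M (left_of b)) <= rank (entry M b))%N) &&
  ((below b \in D) ==> (rank (entry M b) < rank (entry M (below b)))%N).

Definition box_weight (M : {ffun D -> L}) (b : box) : R :=
  (locally_ordered M b)%:R * w (content b) (entry M b).

Definition diagonal_state (M : {ffun D -> L}) (c : int) : X :=
  [ffun i => if in_span p q i c then entry M (box_at i c) else x0].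

Lemma diagonal_state_box (M : {ffun D -> L}) c b : b \in D -> content b = c ->
  diagonal_state M c (strip_of b) = entry M b.
Proof.
move=> bD <-; rewrite ffunE (strip_of_span sysD bD).
by rewrite (strip_ofK sysD bD).
Qed.

Lemma transfer_state (M : {ffun D -> L}) c i :
  transfer (c + 1) (diagonal_state M c) i (diagonal_state M (c + 1) i) =
  if in_span p q i (c + 1) then box_weight M (box_at i (c + 1)) else 1.
Proof.
rewrite /transfer [diagonal_state M (c + 1) i]ffunE.
case: ifP => ic; last by rewrite ic eqxx.
have cb := box_at_content sysD ic.
rewrite /box_weight ic cb; congr (_ * _); congr (_%:R); congr (nat_of_bool _).
rewrite /fits /locally_ordered; congr (_ && _).
  case: (boolP (left_of _ \in D)) => //= bD.
  by rewrite diagonal_state_box // content_left cb addrK.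
case: (boolP (below _ \in D)) => //= bD.
by rewrite diagonal_state_box // content_below cb addrK.
Qed.

(** The contents from [c0] to [c0 + T] enclose all diagonals of [D]: no strip has
    started at the first one and all strips are finished at the last one.  A path
    of states of nonzero weight is the same as a filling of [D], read diagonal
    after diagonal. *)
Theorem tableau_sum_det :
  \sum_(M : {ffun D -> L}) \prod_(b : D) box_weight M (val b) =
  \det (\matrix_(i, j) strip_sum (p i) (q j)).
Proof.
pose m : nat := (\sum_i (absz (p i) + absz (q i)))%N.
have mP i : - (m%:Z) <= p i /\ q i <= m%:Z.
  have : (absz (p i) + absz (q i) <= m)%N by rewrite /m (bigD1 i) //= leq_addr.
  by lia.
pose c0 : int := - (m%:Z) - 1.
pose T : nat := m.*2.+2.
pose xx : X := [ffun=> x0].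
have spanP i c : in_span p q i c -> c0 < c < c0 + T%:Z.
  by rewrite /in_span /c0 /T; have := mP i; lia.
have nospan0 i : in_span p q i c0 = false.
  by apply/negP => /spanP; rewrite ltxx.
have timeS t : c0 + t.+1%:Z = c0 + t%:Z + 1 by lia.
have det0 : \det (\matrix_(i, j) strip_sum (p i) (q j)) = diagonal_det (c0 + 0%:Z) xx.
  congr (\det _); apply/matrixP => i j; rewrite !mxE addr0 /strip_row.
  have := mP i; have := span_nonempty sysD i; rewrite /c0 => pq [pm qm].
  have -> : (q i < - (m%:Z) - 1) = false by lia.
  by have -> : (p i <= - (m%:Z) - 1) = false by lia.
have detT x : diagonal_det (c0 + (0 + T)%N%:Z) x = 1.
  rewrite -[RHS](det1 R n); congr (\det _); apply/matrixP => i j; rewrite !mxE.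
  by rewrite /strip_row; have -> : q i < c0 + (0 + T)%N%:Z by have := mP i; lia.
rewrite det0.
rewrite (@path_sum R X (fun t x => diagonal_det (c0 + t%:Z) x)
  (fun t x y => \prod_i transfer (c0 + t%:Z + 1) x i (y i))
  (fun t x => diagonal_increasing (c0 + t%:Z) x) _ _ T); first last.
- move=> b bD cb; have := strip_of_span sysD bD.
  by rewrite cb addr0 nospan0.
- by move=> t x y; rewrite timeS; apply: transfer_increasing.
- by move=> t x inc; rewrite timeS; apply: diagonal_det_step.
under [RHS]eq_bigr => Y _ do rewrite detT mulr1.
pose fill (Y : T.-tuple X) : {ffun D -> L} :=
  [ffun b : D => nth xx Y (absz (content (val b) - c0 - 1)%R) (strip_of (val b))].
pose states (M : {ffun D -> L}) : T.-tuple X :=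
  [tuple diagonal_state M (c0 + u%:Z + 1) | u < T].
have timeP b : b \in D -> exists2 u : 'I_T,
    absz (content b - c0 - 1)%R = u & content b = c0 + u%:Z + 1.
  move=> bD; have /spanP bnd := strip_of_span sysD bD.
  have uT : (absz (content b - c0 - 1)%R < T)%N by lia.
  by exists (Ordinal uT) => //=; lia.
have nth_states M (u : 'I_T) : nth xx (states M) u = diagonal_state M (c0 + u%:Z + 1).
  by rewrite -tnth_nth tnth_mktuple.
have statesK : cancel states fill.
  move=> M; apply/ffunP => b; rewrite ffunE.
  have [u -> cu] := timeP _ (valP b).
  by rewrite nth_states diagonal_state_box ?(valP b) // entry_val.
(* Paths that do not come from a filling carry a letter other than [x0] for a strip
   that misses the diagonal, so their weight is 0. *)
rewrite (bigID (fun Y => states (fill Y) == Y)) /= [X in _ + X]big1 ?addr0; last first.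
  move=> Y; apply: contraNeq => nz; apply/eqP/eq_from_tnth => u.
  rewrite tnth_mktuple (tnth_nth xx); apply/ffunP => i; rewrite ffunE.
  case: ifP => ic.
    have bD := box_at_in sysD ic; have cb := box_at_content sysD ic.
    rewrite -[box_at i _]/(val (FSetSub bD)) entry_val ffunE /= cb (box_atK sysD ic).
    by have -> : absz (c0 + u%:Z + 1 - c0 - 1)%R = u by lia.
  apply/eqP; rewrite eq_sym; apply: contraNT nz => nx.
  by rewrite (bigD1 u) //= (bigD1 i) //= /transfer add0n ic (negPf nx) !mul0r.
rewrite (reindex_onto states fill) => [|Y /eqP //].
rewrite [RHS](eq_bigl xpredT) => [|M]; last by rewrite statesK !eqxx.
apply: eq_bigr => M _.
transitivity (\prod_(u < T) \prod_(i < n)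
    if in_span p q i (c0 + u%:Z + 1) then box_weight M (box_at i (c0 + u%:Z + 1))
    else 1).
  rewrite pair_big /= -big_mkcond /=.
  pose pos (b : D) : 'I_T * 'I_n :=
    (inord (absz (content (val b) - c0 - 1)%R), strip_of (val b)).
  have posP (b : D) : c0 + (pos b).1%:Z + 1 = content (val b).
    by have [u uE cu] := timeP _ (valP b); rewrite /pos /= uE inord_val.
  rewrite (partition_big pos (fun z => in_span p q z.2 (c0 + z.1%:Z + 1))) => [|b _].
    apply: eq_bigr => -[u i] /= ic; have bD := box_at_in sysD ic.
    rewrite (big_pred1 (FSetSub bD)) //= => b.
    apply/eqP/eqP => [E|->].
      apply/val_inj; rewrite /= -(strip_ofK sysD (valP b)) -posP E /=.
      by congr (box_at _ _); have := congr1 snd E.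
    have [v vE cv] := timeP _ bD.
    rewrite /pos /= vE inord_val (box_atK sysD ic); congr pair.
    apply/val_inj => /=.
    by move: cv; rewrite (box_at_content sysD ic); lia.
  by rewrite posP (strip_of_span sysD (valP b)).
apply: eq_bigr => u _; rewrite add0n.
have -> : nth xx (xx :: states M) u = diagonal_state M (c0 + u%:Z).
  case: u => -[|v] vT /=.
    by apply/ffunP => i; rewrite !ffunE addr0 nospan0.
  by rewrite (nth_states M (Ordinal (ltnW vT))) /= timeS.
by apply: eq_bigr => i _; rewrite nth_states transfer_state.
Qed.

End Diagram.

End Transfer.

(** * Skew diagrams and symplectic tableaux *)

Lemma in_diagram (l : seq nat) (b : box) :
  (b \in diagram l) =
  [&& 1 <= b.1, 1 <= b.2 & b.2 <= (nth 0%N l (absz b.1).-1)%:Z].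
Proof.
case: b => [i j] /=; apply/imfset2P/and3P.
  move=> [k kI [m mI [-> ->]]]; move: kI mI; rewrite /= !mem_iota => kI mI.
  by split; lia.
move=> [i1 j1 jn].
have il : ((absz i).-1 < size l)%N.
  by rewrite ltnNge; apply/negP => sl; move: jn; rewrite nth_default //; lia.
exists (absz i); rewrite /= ?mem_iota; first by lia.
exists (absz j); rewrite /= ?mem_iota; first by lia.
by congr pair; lia.
Qed.

Lemma diagram_down_closed (l : seq nat) (a b : box) : is_partition l ->
  b \in diagram l -> 1 <= a.1 <= b.1 -> 1 <= a.2 <= b.2 -> a \in diagram l.
Proof.
case/andP=> sl _; rewrite !in_diagram => /and3P[b1 b2 bn] /andP[a1 ab1] /andP[a2 ab2].
rewrite a1 a2 /=; apply: (le_trans ab2); apply: (le_trans bn); rewrite lez_nat.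
have ab : ((absz a.1).-1 <= (absz b.1).-1)%N by lia.
have bl : ((absz b.1).-1 < size l)%N.
  by rewrite ltnNge; apply/negP => sz; move: bn; rewrite nth_default //; lia.
have geqT : transitive geq by move=> x y z /= xy yz; apply: leq_trans yz xy.
apply: (sorted_leq_nth geqT leqnn 0%N sl) => //; rewrite inE //.
exact: leq_ltn_trans ab bl.
Qed.

Lemma skew_diagram_convex (la mu : seq nat) : is_partition la ->
  is_partition mu -> box_convex (skew_diagram la mu).
Proof.
move=> laP muP a b z; rewrite !inE => /andP[amu ala] /andP[_ bla] z1 z2.
have /and3P[a1 a2 _] : [&& 1 <= a.1, 1 <= a.2 & a.2 <= (nth 0%N la (absz a.1).-1)%:Z].
  by rewrite -in_diagram.
apply/andP; split; last by apply: (diagram_down_closed laP bla); lia.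
by apply: contra amu => zmu; apply: (diagram_down_closed muP zmu); lia.
Qed.

(** In a convex diagram the monotonicity conditions need only be tested on
    adjacent boxes. *)
Lemma row_le_of_adjacent (D : {fset box}) (e : box -> nat) : box_convex D ->
  (forall b : box, b \in D -> left_of b \in D -> (e (left_of b) <= e b)%N) ->
  forall a b : box, a \in D -> b \in D -> a.1 = b.1 -> a.2 < b.2 -> (e a <= e b)%N.
Proof.
move=> conv adj a b aD bD r lt.
have [k kE] : exists k : nat, b.2 = a.2 + k.+1%:Z.
  by exists (absz (b.2 - a.2)%R).-1; lia.
elim: k => [|k IH] in b bD r lt kE *.
  have lE : left_of b = a.
    by rewrite /left_of kE addrK -r; case: (a).
  by have := adj b bD; rewrite lE; apply.
have lD : left_of b \in D by apply: (conv _ _ _ aD bD) => /=; lia.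
by apply: leq_trans (adj b bD lD); apply: IH => //=; lia.
Qed.

Lemma column_lt_of_adjacent (D : {fset box}) (e : box -> nat) : box_convex D ->
  (forall b : box, b \in D -> below b \in D -> (e b < e (below b))%N) ->
  forall a b : box, a \in D -> b \in D -> a.2 = b.2 -> a.1 < b.1 -> (e a < e b)%N.
Proof.
move=> conv adj a b aD bD r lt.
have [k kE] : exists k : nat, b.1 = a.1 + k.+1%:Z.
  by exists (absz (b.1 - a.1)%R).-1; lia.
elim: k => [|k IH] in a aD r lt kE *.
  have lE : below a = b.
    by rewrite /below r -kE; case: (b).
  by have := adj a aD; rewrite lE; apply.
have lD : below a \in D by apply: (conv _ _ _ aD bD) => /=; lia.
by apply: leq_trans (adj a aD lD) _; apply/ltnW/IH => //=; lia.
Qed.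

Section Zeta.

Variables (R : realType) (N : nat) (a : int -> R[i]) (x0 : letter N).

Definition letter_weight (c : int) (v : letter N) : R[i] :=
  if 2 * - c <= (rank v)%:Z then cpow (letter_abs R v) (- a c) else 0.

Lemma symplectic_tableau_local (D : {fset box}) (M : {ffun D -> letter N}) :
  box_convex D ->
  symplectic_tableau M =
  [forall b : D, locally_ordered (@rank N) x0 M (val b) &&
                 (2 * - content (val b) <= (rank (M b))%:Z)].
Proof.
move=> conv; apply/and3P/forallP => [[/forallP row /forallP col /forallP sp] b|H].
  rewrite sp andbT /locally_ordered entry_val; apply/andP; split; apply/implyP => nD.
    have := forallP (row (FSetSub nD)) b; rewrite /= eqxx /= => /implyP le.
    by rewrite -[left_of _]/(val (FSetSub nD)) entry_val; apply: le; lia.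
  have := forallP (col b) (FSetSub nD); rewrite /= eqxx /= => /implyP lt.
  by rewrite -[below _]/(val (FSetSub nD)) entry_val; apply: lt; lia.
have loc b : b \in D -> locally_ordered (@rank N) x0 M b.
  by move=> bD; have /andP[] := H (FSetSub bD).
split; apply/forallP => b; last by have /andP[] := H b.
  apply/forallP => b'; apply/implyP => /andP[/eqP r lt].
  rewrite -!(entry_val x0).
  apply: (@row_le_of_adjacent _ (fun z => rank (entry x0 M z)) conv) => //.
    by move=> z zD lD; have /andP[/implyP/(_ lD)] := loc z zD.
  - exact: valP.
  - exact: valP.
apply/forallP => b'; apply/implyP => /andP[/eqP r lt].
rewrite -!(entry_val x0).
apply: (@column_lt_of_adjacent _ (fun z => rank (entry x0 M z)) conv) => //.
  by move=> z zD lD; have /andP[_ /implyP/(_ lD)] := loc z zD.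
- exact: valP.
- exact: valP.
Qed.

Lemma zeta_sp_box_weight (D : {fset box}) (s : D -> R[i]) : box_convex D ->
  (forall b : D, s b = a (content (val b))) ->
  zeta_sp N s = \sum_(M : {ffun D -> letter N})
    \prod_(b : D) box_weight (@rank N) letter_weight x0 M (val b).
Proof.
move=> conv sE; rewrite /zeta_sp big_mkcond /=; apply: eq_bigr => M _.
rewrite (symplectic_tableau_local M conv); case: ifP => [/forallP H|/negbT].
  apply: eq_bigr => b _; have /andP[lo sp] := H b.
  by rewrite /box_weight lo mul1r entry_val /letter_weight sp sE.
rewrite negb_forall => /(elimT existsP)[b]; rewrite negb_and => bad.
rewrite (bigD1 b) //= /box_weight entry_val /letter_weight.
by case/orP: bad => /negPf ->; rewrite ?mulr0 !mul0r.
Qed.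

End Zeta.

(** * The strips R[p,q] *)

Section StripBetween.

Variables (d : int -> direction) (p : int).

Lemma content_strip_box k : content (strip_box d p k) = p + k%:Z.
Proof.
elim: k => [|k IH] /=; first by rewrite /content /=; lia.
by move: IH; case: (d _); rewrite /content /=; lia.
Qed.

Lemma predecessor_strip_box k :
  predecessor (d (p + k.+1%:Z)) (strip_box d p k.+1) = strip_box d p k.
Proof.
rewrite /=; case: (d _) => /=; rewrite /left_of /below /= ?addrK ?subrK;
  by case: (strip_box d p k).
Qed.

Lemma strip_box_monotone k l : (k <= l)%N ->
  (strip_box d p l).1 <= (strip_box d p k).1 /\
  (strip_box d p k).2 <= (strip_box d p l).2.
Proof.
move=> /subnK <-; elim: (l - k)%N => [|m [IH1 IH2]] //=.
by case: (d _) => /=; lia.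
Qed.

Lemma in_strip_between q b : p <= q ->
  reflect (exists2 k : nat, p + k%:Z <= q & b = strip_box d p k)
          (b \in strip_between d p q).
Proof.
move=> pq; rewrite /strip_between; apply: (iffP (imfsetP _ _ _ _)) => [[k]|[k kq ->]].
  move=> kI ->; exists k => //; have {kI} : k \in iota 0 (absz (q - p)%R).+1 by [].
  by rewrite mem_iota; lia.
exists k => //; suff : k \in iota 0 (absz (q - p)%R).+1 by [].
by rewrite mem_iota; lia.
Qed.

(** The strip is monotone in both coordinates, so a box lying between two of its
    boxes is squeezed onto the box of the strip having its content. *)
Lemma strip_between_convex q : p <= q -> box_convex (strip_between d p q).
Proof.
move=> pq a b z /(in_strip_between _ pq)[k kq ->] /(in_strip_between _ pq)[l lq ->].
move=> z1 z2; apply/(in_strip_between _ pq).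
have ck := content_strip_box k; have cl := content_strip_box l.
pose m := absz (content z - p)%R.
have cm := content_strip_box m.
have [kl|lk] := leqP k l.
  have [r1 r2] := strip_box_monotone kl.
  have mE : m%:Z = content z - p by move: ck cl; rewrite /m /content; lia.
  have km : (k <= m)%N by move: ck cl; rewrite /content; move: mE; rewrite /content; lia.
  have ml : (m <= l)%N by move: ck cl; rewrite /content; move: mE; rewrite /content; lia.
  have [s1 s2] := strip_box_monotone km; have [t1 t2] := strip_box_monotone ml.
  exists m; first by lia.
  by move: mE cm; case: (z) (strip_box d p m) z1 z2 s1 s2 t1 t2 => [i j] [r s];
    rewrite /content /= => *; congr pair; lia.
have [r1 r2] := strip_box_monotone (ltnW lk).
have mE : m%:Z = content z - p by move: ck cl; rewrite /m /content; lia.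
have lm : (l <= m)%N by move: ck cl; rewrite /content; move: mE; rewrite /content; lia.
have mk : (m <= k)%N by move: ck cl; rewrite /content; move: mE; rewrite /content; lia.
have [s1 s2] := strip_box_monotone lm; have [t1 t2] := strip_box_monotone mk.
exists m; first by lia.
by move: mE cm; case: (z) (strip_box d p m) z1 z2 s1 s2 t1 t2 => [i j] [r s];
  rewrite /content /= => *; congr pair; lia.
Qed.

Lemma strip_between_system q : p <= q ->
  strip_system (strip_between d p q) d (fun _ : 'I_1 => p) (fun _ => q)
    (fun _ => ord0) (fun _ c => strip_box d p (absz (c - p)%R)).
Proof.
move=> pq; split => //.
- move=> b /(in_strip_between _ pq)[k kq ->].
  by rewrite /in_span content_strip_box; lia.
- move=> b /(in_strip_between _ pq)[k kq ->]; rewrite content_strip_box.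
  by congr strip_box; lia.
- move=> _ c /andP[pc cq]; apply/(in_strip_between _ pq).
  by exists (absz (c - p)%R) => //; lia.
- by move=> _ c /andP[pc cq]; rewrite content_strip_box; lia.
- by move=> i c _; rewrite (ord1 i).
- move=> _ c /andP[pc _] _.
  have [k kE] : exists k : nat, c = p + k.+1%:Z by exists (absz (c - p)%R).-1; lia.
  have {1}-> : absz (c - p)%R = k.+1 by lia.
  rewrite kE.
  by rewrite predecessor_strip_box; congr strip_box; lia.
- move=> _; apply/negP => /(in_strip_between _ pq)[k _ kE].
  have := content_predecessor (d p) (strip_box d p (absz (p - p)%R)).
  by rewrite kE !content_strip_box; lia.
Qed.

End StripBetween.

(** For a nonempty strip this is [tableau_sum_det] for the decomposition of the
    strip into itself, whose matrix is 1 x 1. *)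
Lemma hash_entry_strip_sum (R : realType) (N : nat) (a : int -> R[i])
    (d : int -> direction) (x0 : letter N) (E E' : {fset box}) :
  hash_entry N a d E E' =
  strip_sum (@rank N) (letter_weight a) d
    (content (start_box E')) (content (end_box E)).
Proof.
rewrite /hash_entry /hash; set p := content (start_box E'); set q := content _.
case: ifP => [pq|/negbT pq].
  case: eqP => [E0|_].
    have : strip_box d p 0 \in strip_between d p q.
      by apply/in_strip_between => //; exists 0%N => //; rewrite addr0.
    by rewrite E0 inE.
  rewrite (zeta_sp_box_weight x0 (strip_between_convex pq) (fun=> erefl)).
  rewrite (tableau_sum_det _ _ _ (strip_between_convex pq) (strip_between_system d pq)).
  by rewrite det_mx11 mxE.
rewrite -ltNge in pq.
case: ifP => [/eqP pE|/negbT pne]; last first.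
  by rewrite strip_sum_past //; lia.
rewrite eqxx /strip_sum pE eqxx big1 ?addr0 // => y _.
by rewrite tail_sum_past ?mulr0 //; lia.
Qed.

(** * Outside decompositions *)

Lemma box_convex_is_skew_diagram (E : {fset box}) :
  is_skew_diagram E -> box_convex E.
Proof. by case=> la [mu [laP muP _ ->]]; apply: skew_diagram_convex. Qed.

Section DirectedStrip.

Variables (E : {fset box}) (d : int -> direction).
Hypothesis stripE : is_strip E.
Hypothesis approachedE : forall b, b \in E -> b != start_box E ->
  approached_from E b (d (content b)).

(** Two boxes on one diagonal of a convex set span a 2 x 2 block. *)
Lemma strip_content_inj (a b : box) :
  a \in E -> b \in E -> content a = content b -> a = b.
Proof.
case: stripE => _ /box_convex_is_skew_diagram conv _ no2x2.
wlog le : a b / a.1 <= b.1.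
  move=> H aE bE ab; have [le|/ltW le] := leP a.1 b.1; first exact: H.
  by apply/esym/H.
move=> aE bE; rewrite /content => ab; move: le; rewrite le_eqVlt => /orP[/eqP r|lt].
  by apply/eqP; rewrite /eq_op /=; apply/andP; split; apply/eqP; lia.
case: no2x2; exists a; split=> //; apply: (conv _ _ _ aE bE) => /=; lia.
Qed.

Lemma strip_predecessor (b : box) : b \in E -> b != start_box E ->
  predecessor (d (content b)) b \in E.
Proof. by move=> bE /(approachedE bE); case: (d _). Qed.

(** From every box but the starting one a predecessor can be reached, so a box of
    minimal content is the starting box. *)
Lemma start_box_min : start_box E \in E /\
  (forall b, b \in E -> content (start_box E) <= content b).
Proof.
have [/fset0Pn[b0 b0E] _ _ _] := stripE.
case: (@arg_minP _ int E (FSetSub b0E) xpredT (fun b : E => content (val b))) => // m _ minm.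
have mE : val m = start_box E.
  apply/eqP; apply: contraT => nm.
  have pE := strip_predecessor (valP m) nm.
  by have := minm (FSetSub pE) isT; rewrite /= content_predecessor; lia.
by rewrite -mE; split=> [|b bE]; [apply: valP | apply: (minm (FSetSub bE))].
Qed.

(** Walking backwards from [b] the strip meets every diagonal down to that of its
    starting box, moving only leftwards and downwards. *)
Lemma strip_back (b : box) (k : nat) : b \in E ->
  content (start_box E) <= content b - k%:Z ->
  exists z : box, [/\ z \in E, content z = content b - k%:Z,
                      b.1 <= z.1 & z.2 <= b.2].
Proof.
move=> bE; elim: k => [|k IH] le.
  by exists b; split=> //; lia.
have [z [zE zc z1 z2]] : exists z : box, [/\ z \in E, content z = content b - k%:Z,
                      b.1 <= z.1 & z.2 <= b.2] by apply: IH; lia.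
have nz : z != start_box E.
  by apply: contraTneq le => <-; rewrite zc; lia.
have pE := strip_predecessor zE nz.
exists (predecessor (d (content z)) z); split=> //.
- by rewrite content_predecessor zc; lia.
- by case: (d _) => /=; lia.
- by case: (d _) => /=; lia.
Qed.

(** By [strip_content_inj] the walk backwards from a box of maximal content passes
    through all boxes of the strip, so that this box is topmost and rightmost. *)
Lemma end_box_max : end_box E \in E /\
  (forall b, b \in E -> content b <= content (end_box E)).
Proof.
have [m mE maxm] : exists2 m : box, m \in E &
    forall b : box, b \in E -> content b <= content m.
  have [/fset0Pn[b0 b0E] _ _ _] := stripE.
  case: (@arg_maxP _ int E (FSetSub b0E) xpredT (fun b : E => content (val b))) => // m _ H.
  by exists (val m) => [|b bE]; [apply: valP | apply: (H (FSetSub bE))].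
have mP (b : box) : b \in E -> m.1 <= b.1 /\ b.2 <= m.2.
  move=> bE; have le := maxm b bE; have [_ /(_ _ bE) ge] := start_box_min.
  have [|z [zE zc z1 z2]] := @strip_back m (absz (content m - content b)%R) mE.
    by lia.
  suff -> : b = z by [].
  by apply: strip_content_inj => //; lia.
rewrite /end_box; case: pickP => [e /forallP eP|none] /=; last first.
  have := none (FSetSub mE); rewrite -[X in _ = X]/(~~ true) => /negbT/negP[].
  by apply/forallP => b; have [-> ->] := mP _ (valP b).
split; first exact: valP.
move=> b bE; apply: (le_trans (maxm b bE)).
by have /andP[e1 e2] := eP (FSetSub mE); apply: lerB.
Qed.

Definition box_of_content (c : int) : box :=
  odflt (0, 0) (omap val [pick b : E | content (val b) == c]).

Lemma box_of_contentP c : content (start_box E) <= c <= content (end_box E) ->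
  box_of_content c \in E /\ content (box_of_content c) = c.
Proof.
case/andP=> sc ce; rewrite /box_of_content.
case: pickP => [b /eqP bc|none] /=; first by split=> //; apply: valP.
have [eE _] := end_box_max.
have [|z [zE zc _ _]] := @strip_back (end_box E)
  (absz (content (end_box E) - c)%R) eE; first by lia.
have zE' : content z = c by lia.
by have := none (FSetSub zE); rewrite /= zE' eqxx.
Qed.

Lemma box_of_contentK (b : box) : b \in E -> box_of_content (content b) = b.
Proof.
move=> bE; have [_ /(_ _ bE) ge] := start_box_min.
have [_ /(_ _ bE) le] := end_box_max.
have [|xE xc] := @box_of_contentP (content b); first by rewrite ge.
exact: strip_content_inj.
Qed.

End DirectedStrip.

Lemma outside_decomposition_system (D : {fset box}) (n : nat)
    (theta : 'I_n.+1 -> {fset box}) (d : int -> direction) :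
  outside_decomposition D theta -> compatible_directions D theta d ->
  strip_system D d (fun i => content (start_box (theta i)))
    (fun i => content (end_box (theta i)))
    (fun b => odflt ord0 [pick i | b \in theta i])
    (fun i => box_of_content (theta i)).
Proof.
case=> stripT disj cover _ [appr startP].
have apprT i b : b \in theta i -> b != start_box (theta i) ->
    approached_from (theta i) b (d (content b)) by apply: appr.
have sub i b : b \in theta i -> b \in D by move=> bi; apply/cover; exists i.
have stE i b : b \in theta i -> odflt ord0 [pick i | b \in theta i] = i.
  move=> bi; case: pickP => [j bj|/(_ i)] /=; last by rewrite bi.
  apply/eqP; apply: contraT => /disj /fdisjointP/(_ _ bj).
  by rewrite bi.
have smin i := start_box_min (stripT i) (apprT i).
have emax i := end_box_max (stripT i) (apprT i).
have bocP i c (ic : in_span (fun i => content (start_box (theta i)))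
    (fun i => content (end_box (theta i))) i c) :=
  box_of_contentP (stripT i) (apprT i) ic.
have bocK i b := @box_of_contentK _ _ (stripT i) (apprT i) b.
split=> [i|b bD|b bD|i c ic|i c ic|i c ic|i c ic1 ic|i] /=.
- by have [sE _] := smin i; have [_ /(_ _ sE)] := emax i.
- have /cover[i bi] := bD; rewrite (stE i b bi) /in_span.
  have [_ -> //] := smin i; by have [_ ->] := emax i.
- by have /cover[i bi] := bD; rewrite (stE i b bi) bocK.
- by have [/sub] := bocP i c ic.
- by have [] := bocP i c ic.
- by have [xi _] := bocP i c ic; apply: stE.
- have [xi xc] := bocP i c ic; have [yi yc] := bocP i _ ic1.
  have nstart : box_of_content (theta i) c != start_box (theta i).
    by apply: contraTneq ic1 => E; rewrite /in_span -E xc; lia.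
  have := strip_predecessor (apprT i) xi nstart; rewrite xc => pE.
  apply: (strip_content_inj (stripT i)) => //.
  by rewrite content_predecessor xc yc.
- have [sE _] := smin i; rewrite bocK //.
  by have := startP i; case: (d _) => /= /andP[].
Qed.

Theorem theorem7p4 (R : realType) (lambda mu : seq nat) (N n : nat)
    (a : int -> complex R) (s : skew_diagram lambda mu -> complex R)
    (theta : 'I_n -> {fset box}) (d : int -> direction)
    (Hlambda : is_partition lambda) (Hmu : is_partition mu)
    (Hsub : fsubset (diagram mu) (diagram lambda))
    (HN : (0 < N)%N)
    (Hs : forall b : skew_diagram lambda mu, s b = a (content (val b)))
    (Htheta : outside_decomposition (skew_diagram lambda mu) theta)
    (Hd : compatible_directions (skew_diagram lambda mu) theta d) :
  zeta_sp N s =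
  (\det (\matrix_(i < n, j < n) hash_entry N a d (theta i) (theta j)))%R.
Proof.
pose x0 : letter N := (Ordinal HN, false).
have conv := skew_diagram_convex Hlambda Hmu.
rewrite (zeta_sp_box_weight x0 conv Hs).
(* Without strips there is no value for [strip_of]; both sides are then 1. *)
case: n => [|n] in theta Htheta Hd *.
  have D0 (b : skew_diagram lambda mu) : False.
    by have [_ _ /(_ (val b))[/(_ (valP b))[[]]]] := Htheta.
  rewrite det_mx00 (big_pred1 [ffun=> x0]) => [|M]; last first.
    by apply/esym/eqP/ffunP => b; case: (D0 b).
  by rewrite big1 // => b; case: (D0 b).
rewrite (tableau_sum_det _ _ _ conv (outside_decomposition_system Htheta Hd)).
rewrite -det_tr; congr (\det _); apply/matrixP => i j; rewrite !mxE.
by rewrite (hash_entry_strip_sum _ _ x0).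
Qed.
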